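(* Let $m$ be an odd positive integer and let $W=(w_{-r},\ldots,w_r)\in\mathbb{Z}^{2r+1}$ be the weight sequence of a one-dimensional additive cellular automaton such that $\sigma=2\sigma'$ and $\sigma$ is invertible modulo $m$. Let $a,d\in\mathbb{Z}/m\mathbb{Z}$ with $d$ invertible. Then, in the orbit $\mathcal{O}(\mathrm{AP}(a,d))$, every $(0,1)$-antisymmetric triangle of orientation $(1,1)$ or $(-1,-1)$ and of size $s$ is balanced, for all positive integers $s\equiv 0$ or $-1\pmod{\mathrm{lcm}(\mathrm{pord}_m(\sigma),m)}$.
   Context: The ACA with weights $W$ maps a sequence $(a_i)_{i\in\mathbb{Z}}$ of $\mathbb{Z}/m\mathbb{Z}$ to $\left(\sum_{j=-r}^{r}w_ja_{i+j}\right)_{i\in\mathbb{Z}}$; $\sigma=\sum_jw_j$, $\sigma'=\sum_j jw_j$. $\mathrm{AP}(a,d)=(a+id)_{i\in\mathbb{Z}}$. The orbit is the array $(a_{i,j})_{(i,j)\in\mathbb{Z}\times\mathbb{N}}$ whose $j$-th row is $\partial^j(\mathrm{AP}(a,d))$. The triangle with principal vertex $j\in\mathbb{Z}\times\mathbb{N}$, orientation $\varepsilon\in\{-1,1\}^2$ and size $s$ is the multiset $\{a_{j+\varepsilon\cdot k}: k\in\mathbb{N}^2,\ k_1+k_2\le s-1\}$ ($\varepsilon\cdot k=(\varepsilon_1k_1,\varepsilon_2k_2)$, indices in $\mathbb{Z}\times\mathbb{N}$). It is $(0,1)$-antisymmetric if $a_{j+\varepsilon\cdot k}+a_{j+\varepsilon\cdot(s-1-k_1-k_2,\,k_2)}=0$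 for all $k\in\mathbb{N}^2$ with $k_1+k_2\le s-1$. Balanced means every element of $\mathbb{Z}/m\mathbb{Z}$ occurs with the same multiplicity. $\mathrm{pord}_m(\sigma)$ is the multiplicative order of $\sigma$ in $(\mathbb{Z}/m\mathbb{Z})^*/\{-1,1\}$, i.e. the least $k\ge1$ with $\sigma^k\equiv\pm1\pmod m$. *)

(* Defs.v *)
From HB Require Import structures.
From mathcomp Require Import all_boot all_order all_algebra cyclic.

Set Implicit Arguments.
Unset Strict Implicit.
Unset Printing Implicit Defensive.

Import GRing.Theory Num.Theory.
Local Open Scope ring_scope.

(* Z/mZ for m > 0, including the trivial ring m = 1 (where 'Z_m would be Z/2Z).
   It is a zmodType; integers act by *~, and the product is Zp_mul. *)
Notation Zmod m := 'I_m.-1.+1.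

Definition invertible (m : nat) (d : Zmod m) : Prop :=
  exists e : Zmod m, Zp_mul d e = Zp1.

Definition invertible_mod (m : nat) (x : int) : Prop :=
  exists y : int, (x * y = 1 %[mod m])%Z.

(* W = (w_{-r}, ..., w_r): entry number j of the tuple is w_{j-r}. *)
Definition widx (r : nat) (j : 'I_r.*2.+1) : int := (j : nat)%:Z - r%:Z.

Definition sigma (r : nat) (W : r.*2.+1.-tuple int) : int :=
  \sum_(j < r.*2.+1) tnth W j.

Definition sigma' (r : nat) (W : r.*2.+1.-tuple int) : int :=
  \sum_(j < r.*2.+1) widx j * tnth W j.

Definition aca (m r : nat) (W : r.*2.+1.-tuple int) (u : int -> Zmod m) :
    int -> Zmod m :=
  fun i => \sum_(j < r.*2.+1) u (i + widx j) *~ tnth W j.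

Definition AP (m : nat) (a d : Zmod m) : int -> Zmod m := fun i => a + d *~ i.

(* aca_orbit W u i j is the entry in column i of row j. *)
Definition aca_orbit (m r : nat) (W : r.*2.+1.-tuple int) (u : int -> Zmod m)
    (i : int) (j : nat) : Zmod m :=
  iter j (aca W) u i.

Definition triangle_in_range (j : int * nat) (e : int * int) (s : nat) : Prop :=
  forall k1 k2 : nat, (k1 + k2 <= s - 1)%N -> 0 <= j.2%:Z + e.2 * k2%:Z.

(* The value a_{j + e.k}. The absolute value only casts the row index to nat:
   it is the identity on the triangles satisfying triangle_in_range. *)
Definition entry (m : nat) (A : int -> nat -> Zmod m) (j : int * nat)
    (e : int * int) (k1 k2 : nat) : Zmod m :=
  A (j.1 + e.1 * k1%:Z) `|(j.2%:Z + e.2 * k2%:Z)%R|%N.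

(* The multiset, as a sequence up to order; k1, k2 <= s - 1 is automatic. *)
Definition triangle (m : nat) (A : int -> nat -> Zmod m) (j : int * nat)
    (e : int * int) (s : nat) : seq (Zmod m) :=
  [seq entry A j e k.1 k.2 |
    k : 'I_s * 'I_s in [pred k : 'I_s * 'I_s | (k.1 + k.2 <= s - 1)%N]].

Definition antisymmetric01 (m : nat) (A : int -> nat -> Zmod m) (j : int * nat)
    (e : int * int) (s : nat) : Prop :=
  forall k1 k2 : nat, (k1 + k2 <= s - 1)%N ->
    entry A j e k1 k2 + entry A j e (s - 1 - k1 - k2)%N k2 = 0.

Definition balanced (m : nat) (t : seq (Zmod m)) : Prop :=
  forall x y : Zmod m, count_mem x t = count_mem y t.

Definition pm1_power (m : nat) (x : int) (k : nat) : bool :=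
  (0 < k)%N && ((x ^+ k == 1 %[mod m])%Z || (x ^+ k == - 1 %[mod m])%Z).

Lemma pm1_power_exists (m : nat) (x : int) :
  invertible_mod m x -> exists k, pm1_power m x k.
Proof.
move=> [y xy1].
have cop : coprime `|x| m.
  rewrite /coprime -dvdn1; set g := gcdn _ _.
  have gm : (g%:Z %| m%:Z)%Z by rewrite dvdzE /= dvdn_gcdr.
  have gx : (g%:Z %| x)%Z by rewrite dvdzE /= dvdn_gcdl.
  have gxy : (g%:Z %| x * y)%Z by rewrite dvdz_mulr.
  have : (m%:Z %| x * y - 1)%Z by rewrite -eqz_mod_dvd; apply/eqP.
  move/(dvdz_trans gm) => gB.
  have : (g%:Z %| x * y - (x * y - 1))%Z by apply: rpredB.
  by rewrite opprB addrC subrK dvdzE.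
have [m0|m_gt0] := posnP m.
  exists 1%N; rewrite m0 /pm1_power /= expr1.
  move: cop; rewrite m0 /coprime gcdn0 => /eqP.
  by case: x {xy1} => n /= [->]; rewrite eqxx ?orbT.
exists (totient m * 2)%N; rewrite /pm1_power muln_gt0 totient_gt0 m_gt0 /=.
apply/orP; left; apply/eqP.
have -> : x ^+ (totient m * 2) = ((`|x| ^ totient m) ^ 2)%N.
  by rewrite exprM -abszX -[RHS]/(`|(x ^+ totient m)|%N%:Z ^+ 2) abszE
     real_normK ?num_real.
by rewrite modz_nat -modnXm Euler_exp_totient // modnXm exp1n modz_nat.
Qed.

Definition pord (m : nat) (x : int) (hx : invertible_mod m x) : nat :=
  ex_minn (pm1_power_exists hx).

(* Main.v *)
Require Import Defs.
From mathcomp Require Import all_boot all_order all_algebra cyclic.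
From mathcomp Require Import zify ring.

(** Since sigma = 2 sigma', the orbit satisfies
    2 a_(i,j) = sigma^j (2a + (2i + j) d).  Antisymmetry of the first row of the
    triangle pins down the centre, and then the row of length n + 1 is, up to a
    fixed unit, rho^-n * {-n, -n + 2, ..., n} with rho = sigma or sigma^-1.  It
    remains to see that, when m | L and rho^L = +-1 mod m, the union of these
    rows for n < L is equidistributed modulo m.  The multiplicity N_n(y) of y in
    {-n, ..., n} satisfies N_n(y + 1) - N_n(y - 1) = [y = -(n+1)] - [y = n+1],
    which determines N_n up to a constant because m is odd.  Summing over the n
    congruent to t modulo P = phi(m) gives, up to a constant, a multiple of N_t
    taken modulo gcd(P, m) < m, and one concludes by induction on m. *)

Set Implicit Arguments.
Unset Strict Implicit.
Unset Printing Implicit Defensive.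

Import GRing.Theory Num.Theory.
Local Open Scope ring_scope.

Lemma dvdzN (d x : int) : (d %| - x)%Z = (d %| x)%Z.
Proof. exact: rpredN. Qed.

(** * Periodic functions with an odd period, up to constants *)

Definition eq_upto_const (f g : int -> int) : Prop :=
  forall x y, f x - f y = g x - g y.

(** [G] has period 2 as well as the odd period [m], hence period 1. *)
Lemma odd_periodic_const (m : nat) (G : int -> int) : odd m ->
  (forall y, G (y + m%:Z) = G y) -> (forall y, G (y + 1) = G (y - 1)) ->
  forall x y, G x = G y.
Proof.
move=> m_odd Gm G2.
have Gdbl k y : G (y + (k.*2)%:Z) = G y.
  elim: k => [|k IH]; first by rewrite addr0.
  rewrite -IH; have -> : y + (k.+1.*2)%:Z = (y + (k.*2)%:Z + 1) + 1 by lia.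
  by rewrite G2 addrK.
have G1 y : G (y + 1) = G y.
  rewrite -[RHS]Gm -(Gdbl m./2 (y + 1)); congr G.
  by have := odd_double_half m; rewrite m_odd; lia.
suff G0 x : G x = G 0 by move=> x y; rewrite !G0.
elim/int_rect: x => // n IH; first by rewrite intS addrC G1.
by rewrite -[LHS]G1 -[RHS]IH; congr G; lia.
Qed.

Lemma eq_upto_const_diff (m : nat) (f g : int -> int) : odd m ->
  (forall y, f (y + m%:Z) = f y) -> (forall y, g (y + m%:Z) = g y) ->
  (forall y, f (y + 1) - f (y - 1) = g (y + 1) - g (y - 1)) ->
  eq_upto_const f g.
Proof.
move=> m_odd fm gm fg x y.
suff : f x - g x = f y - g y by lia.
apply: (@odd_periodic_const m (fun z => f z - g z)) => // z.
- by rewrite fm gm.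
- by have := fg z; lia.
Qed.

(** * Residue counts in a single row *)

(* Multiplicity of the residue y modulo m in the row -n, -n + 2, ..., n. *)
Definition row_count (m n : nat) (y : int) : int :=
  \sum_(k < n.+1) ((m%:Z %| k%:Z *+ 2 - n%:Z - y)%Z : nat)%:Z.

(** Passing from [y + 1] to [y - 1] has the same effect as shifting [k] by one, so the difference
    telescopes to its two ends. *)
Lemma row_count_diff (m n : nat) (y : int) :
  row_count m n (y + 1) - row_count m n (y - 1) =
  ((m%:Z %| n.+1%:Z + y)%Z : nat)%:Z - ((m%:Z %| n.+1%:Z - y)%Z : nat)%:Z.
Proof.
rewrite /row_count -sumrB.
pose f k : int := - ((m%:Z %| k%:Z *+ 2 - n.+1%:Z - y)%Z : nat)%:Z.
rewrite (eq_bigr (fun k : 'I_n.+1 => f k.+1 - f k)) => [|k _]; last first.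
  rewrite /f opprK addrC.
  congr (- (nat_of_bool (_ %| _)%Z)%:Z + (nat_of_bool (_ %| _)%Z)%:Z); lia.
rewrite -(big_mkord xpredT (fun k => f k.+1 - f k)) telescope_sumr //.
rewrite /f opprK addrC -[in LHS]dvdzN.
congr ((nat_of_bool (_ %| _)%Z)%:Z - (nat_of_bool (_ %| _)%Z)%:Z); lia.
Qed.

Lemma row_count_mod (m n : nat) (x y : int) :
  (m%:Z %| x - y)%Z -> row_count m n x = row_count m n y.
Proof.
move=> xy; apply: eq_bigr => k _; congr (nat_of_bool _)%:Z.
have -> : k%:Z *+ 2 - n%:Z - y = (k%:Z *+ 2 - n%:Z - x) + (x - y) by lia.
by rewrite (rpredDr _ xy).
Qed.

Lemma row_count_periodic (g m n : nat) (y : int) :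
  (g %| m)%N -> row_count g n (y + m%:Z) = row_count g n y.
Proof. by move=> gm; apply: row_count_mod; rewrite addrAC subrr add0r. Qed.

Lemma row_countN (m n : nat) (y : int) : row_count m n (- y) = row_count m n y.
Proof.
rewrite /row_count (reindex_inj rev_ord_inj) /=.
apply: eq_bigr => k _; congr (nat_of_bool _)%:Z.
rewrite -dvdzN; congr (_ %| _)%Z.
by have := ltn_ord k; lia.
Qed.

(** The boundary terms in [row_count_diff] depend on [n] only modulo [m]. *)
Lemma row_countD (m n L : nat) : odd m -> (m %| L)%N ->
  eq_upto_const (row_count m (n + L)) (row_count m n).
Proof.
move=> m_odd mL; apply: (eq_upto_const_diff m_odd) => y;
  [exact: row_count_periodic | exact: row_count_periodic | rewrite !row_count_diff].
have mL' : (m%:Z %| L%:Z)%Z by [].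
congr ((nat_of_bool _)%:Z - (nat_of_bool _)%:Z).
- have -> : (n + L).+1%:Z + y = n.+1%:Z + y + L%:Z by lia.
  by rewrite rpredDr.
- have -> : (n + L).+1%:Z - y = n.+1%:Z - y + L%:Z by lia.
  by rewrite rpredDr.
Qed.

(** When [m] divides [n + 1], both boundary terms in [row_count_diff] test whether [m] divides [y],
    so they cancel. *)
Lemma row_count_const (m n : nat) (x y : int) : odd m -> (m %| n.+1)%N ->
  row_count m n x = row_count m n y.
Proof.
move=> m_odd mn; apply: (odd_periodic_const m_odd) => z.
  exact: row_count_periodic.
apply/eqP; rewrite -subr_eq0 row_count_diff.
have mn' : (m%:Z %| n.+1%:Z)%Z by [].
by rewrite !(rpredDl _ mn') rpredN subrr.
Qed.

(** * Fans: unions of rescaled rows *)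

Lemma sum_mul_split (L k : nat) (f : nat -> int) :
  \sum_(n < k * L) f n = \sum_(q < k) \sum_(i < L) f (q * L + i)%N.
Proof.
elim: k => [|k IH]; first by rewrite !big_ord0.
by rewrite big_ord_recr /= -IH mulSn addnC big_split_ord.
Qed.

(** For [rho] a unit modulo [m], this is the multiplicity of [x] in the union of the rows rho^-n *
    {-n, -n + 2, ..., n}; scaling [x] instead of the row avoids inverses. *)
Definition fan_count (m : nat) (rho : int) (L : nat) (x : int) : int :=
  \sum_(n < L) row_count m n (rho ^+ n * x).

Definition pm1_mod (m : nat) (z : int) : bool :=
  (m%:Z %| z - 1)%Z || (m%:Z %| z + 1)%Z.

Lemma pm1_modX (m : nat) (z : int) (k : nat) : pm1_mod m z -> pm1_mod m (z ^+ k).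
Proof.
move=> hz; elim: k => [|k]; first by rewrite /pm1_mod subrr dvdz0.
rewrite /pm1_mod exprSr; move: hz; rewrite /pm1_mod.
set w := z ^+ k.
have e1 : w * z - 1 = w * (z - 1) + (w - 1) by ring.
have e2 : w * z - 1 = w * (z + 1) - (w + 1) by ring.
have e3 : w * z + 1 = w * (z - 1) + (w + 1) by ring.
have e4 : w * z + 1 = w * (z + 1) - (w - 1) by ring.
case/orP=> hz /orP[hw|hw].
- by rewrite e1 rpredD // dvdz_mull.
- by rewrite e3 (rpredD _ hw) ?orbT // dvdz_mull.
- by rewrite e4 (rpredB _ hw) ?orbT // dvdz_mull.
- by rewrite e2 rpredB // dvdz_mull.
Qed.

Lemma row_count_pm1 (m n : nat) (z x : int) :
  pm1_mod m z -> row_count m n (z * x) = row_count m n x.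
Proof.
case/orP=> hz; last rewrite -[RHS]row_countN; apply: row_count_mod.
- have -> : z * x - x = (z - 1) * x by ring.
  exact: dvdz_mulr.
- have -> : z * x - - x = (z + 1) * x by ring.
  exact: dvdz_mulr.
Qed.

(** Each block of [L] consecutive rows contributes the same difference: row [q * L + i] agrees with
    row [i] up to a constant, and the symmetry of rows absorbs the factor rho^(qL) = +-1. *)
Lemma fan_count_mul (m : nat) (rho : int) (L k : nat) (x y : int) :
  odd m -> (m %| L)%N -> pm1_mod m (rho ^+ L) ->
  fan_count m rho (k * L) x - fan_count m rho (k * L) y =
  k%:Z * (fan_count m rho L x - fan_count m rho L y).
Proof.
move=> m_odd mL hrho.
rewrite /fan_count (sum_mul_split L k (fun n => row_count m n (rho ^+ n * x))).
rewrite (sum_mul_split L k (fun n => row_count m n (rho ^+ n * y))).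
rewrite -!sumrB (eq_bigr (fun _ => \sum_(i < L)
  (row_count m i (rho ^+ i * x) - row_count m i (rho ^+ i * y)))).
  by rewrite sumr_const card_ord -mulr_natl natz.
move=> q _; rewrite -sumrB; apply: eq_bigr => i _.
rewrite [in LHS]addnC (row_countD _ m_odd (dvdn_mull _ mL)).
by rewrite addnC !exprD mulnC exprM -!mulrA !(row_count_pm1 _ _ (pm1_modX _ hrho)).
Qed.

(** * Rows whose index lies in one residue class *)

Lemma sum_shift_periodic (L : nat) (f : nat -> int) :
  (forall q, f (q + L)%N = f q) ->
  forall u, \sum_(q < L) f (q + u)%N = \sum_(q < L) f q.
Proof.
move=> fL; elim=> [|u IH]; first by apply: eq_bigr => q _; rewrite addn0.
rewrite -IH; case: L fL {IH} => [|L] fL; first by rewrite !big_ord0.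
rewrite big_ord_recr big_ord_recl /= addrC add0n; congr (_ + _).
  by rewrite -[RHS]fL; congr f; lia.
by apply: eq_bigr => q _; rewrite /bump /=; congr f; lia.
Qed.

(** If P u = z modulo [m] is solvable, that is if gcd(P, m) divides [z], shifting [q] by [u] removes
    [z]; otherwise every term vanishes. *)
Lemma sum_dvd_multiples (m P L : nat) (z : int) : (0 < m)%N -> (m %| L)%N ->
  \sum_(q < L) ((m%:Z %| (P * q)%N%:Z + z)%Z : nat)%:Z =
  (\sum_(q < L) ((m%:Z %| (P * q)%N%:Z)%Z : nat)%:Z) *
  ((((gcdn P m)%:Z) %| z)%Z : nat)%:Z.
Proof.
move=> m_gt0 mL.
case: (boolP (_ %| z)%Z) => gz; last first.
  rewrite mulr0 big1 // => q _; case: (boolP (_ %| _)%Z) => // mz.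
  case/negP: gz; have gm : ((gcdn P m)%:Z %| m%:Z)%Z by exact: dvdn_gcdr.
  have := dvdz_trans gm mz; rewrite rpredDl //.
  rewrite PoszM dvdz_mulr //; exact: dvdn_gcdl.
rewrite mulr1.
have [u hu] : exists u : nat, (m%:Z %| (P * u)%N%:Z - z)%Z.
  case/dvdzP: gz => c zc.
  have [a b ab _] := egcdzP P%:Z m%:Z.
  (* The Bezout solution [a * c] may be negative, so its residue modulo [m] is taken. *)
  exists `|((a * c) %% m%:Z)%Z|%N.
  rewrite PoszM gez0_abs ?modz_ge0 //; last by lia.
  have -> : z = c * (a * P%:Z + b * m%:Z) by rewrite zc ab.
  rewrite (_ : _ - _ = (((a * c) %% m%:Z)%Z - a * c) * P%:Z - c * b * m%:Z); last by ring.
  apply: rpredB; last exact: dvdz_mull.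
  by rewrite dvdz_mulr // -eqz_mod_dvd modz_mod.
rewrite -[RHS](sum_shift_periodic (f := fun q => ((m%:Z %| (P * q)%N%:Z)%Z : nat)%:Z) _ u).
  apply: eq_bigr => q _; congr (nat_of_bool _)%:Z.
  have -> : (P * (q + u))%N%:Z = (P * q)%N%:Z + z + ((P * u)%N%:Z - z) by lia.
  by rewrite (rpredDr _ hu).
move=> q; congr (nat_of_bool _)%:Z.
rewrite mulnDr PoszD rpredDr //.
exact: (dvdn_mull P mL).
Qed.

(** Both sides have the same differences between [y + 1] and [y - 1]: summing the boundary terms of
    the rows [P * q + t] over [q] turns divisibility by [m] into divisibility by gcd(P, m). *)
Lemma sum_row_count_class (m P L t : nat) : odd m -> (m %| L)%N ->
  eq_upto_const (fun y => \sum_(q < L) row_count m (P * q + t) y)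
    (fun y => (\sum_(q < L) ((m%:Z %| (P * q)%N%:Z)%Z : nat)%:Z) *
              row_count (gcdn P m) t y).
Proof.
move=> m_odd mL; have m_gt0 : (0 < m)%N by case: m m_odd {mL}.
apply: (eq_upto_const_diff m_odd) => y.
- by apply: eq_bigr => q _; rewrite row_count_periodic.
- by rewrite row_count_periodic // dvdn_gcdr.
rewrite -mulrBr row_count_diff mulrBr -!sum_dvd_multiples // -!sumrB.
apply: eq_bigr => q _; rewrite row_count_diff.
congr ((nat_of_bool (_ %| _)%Z)%:Z - (nat_of_bool (_ %| _)%Z)%:Z); lia.
Qed.

(** * Equidistribution of fans, by induction on the modulus *)

Lemma totient_lt (m : nat) : (1 < m)%N -> (totient m < m)%N.
Proof.
move=> m_gt1; rewrite totient_count_coprime big_ltn ?(ltnW m_gt1) //.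
have -> : coprime m 0 = false by rewrite /coprime gcdn0; apply/eqP; lia.
have : (\sum_(1 <= d < m) coprime m d <= \sum_(1 <= d < m) 1)%N.
  by apply: leq_sum => d _; exact: leq_b1.
rewrite sum_nat_const_nat; lia.
Qed.

(** Euler's theorem applies to the absolute value of [x]; the sign of the power accounts for +-1. *)
Lemma Euler_pm1 (m : nat) (x : int) :
  coprime `|x| m -> pm1_mod m (x ^+ totient m).
Proof.
move=> cop; have : (m%:Z %| (`|x| ^ totient m)%N%:Z - 1)%Z.
  by rewrite -eqz_mod_dvd !modz_nat Euler_exp_totient.
rewrite -abszX /pm1_mod; case: (intP (x ^+ _)) => [|n|n] /=.
- by move=> ->.
- by move=> ->.
- by rewrite orbC -[X in X || _]dvdzN opprD opprK => ->.
Qed.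

Lemma pm1_mod_coprime (m : nat) (x : int) (L : nat) : (0 < L)%N ->
  pm1_mod m (x ^+ L) -> coprime `|x| m.
Proof.
move=> L_gt0 hx; rewrite /coprime -dvdn1; set g := gcdn _ _.
have gx : (g%:Z %| x ^+ L)%Z.
  by rewrite -(prednK L_gt0) exprS dvdz_mulr // dvdzE /= dvdn_gcdl.
have gm : (g%:Z %| m%:Z)%Z by exact: dvdn_gcdr.
case/orP: hx => /(dvdz_trans gm); rewrite (rpredDl _ gx) ?dvdzN //.
Qed.

Lemma pm1_mod_dvd (g m : nat) (z : int) :
  (g %| m)%N -> pm1_mod m z -> pm1_mod g z.
Proof.
move=> gm; have {}gm : (g%:Z %| m%:Z)%Z by [].
by case/orP=> /(dvdz_trans gm) h; rewrite /pm1_mod h ?orbT.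
Qed.

Lemma fan_count_const (m : nat) (rho : int) (L : nat) (x y : int) :
  odd m -> (m %| L)%N -> pm1_mod m (rho ^+ L) ->
  fan_count m rho L x = fan_count m rho L y.
Proof.
elim/ltn_ind: m L x y => m IH L x y m_odd mL hL.
case: (posnP L) => [->|L_gt0]; first by rewrite /fan_count !big_ord0.
have [m1|m_neq1] := eqVneq m 1%N.
  by apply: eq_bigr => n _; apply: row_count_mod; rewrite m1 dvd1z.
have m_gt1 : (1 < m)%N by case: m m_odd m_neq1 {IH mL hL} => [|[]].
(* This [P] makes rho^P = +-1, so [rho] acts alike, up to sign, on all rows of a class modulo [P];
   and P < m forces gcd(P, m) < m. *)
pose P := totient m; have P_gt0 : (0 < P)%N by rewrite totient_gt0 ltnW.
have hP : pm1_mod m (rho ^+ P) by apply/Euler_pm1/(pm1_mod_coprime L_gt0).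
have class_sum z : fan_count m rho (P * L) z =
    \sum_(t < P) \sum_(q < L) row_count m (P * q + t) (rho ^+ t * z).
  rewrite /fan_count mulnC.
  rewrite (sum_mul_split P L (fun n => row_count m n (rho ^+ n * z))).
  rewrite exchange_big /=; apply: eq_bigr => t _; apply: eq_bigr => q _.
  by rewrite mulnC exprD exprM -mulrA (row_count_pm1 _ _ (pm1_modX _ hP)).
(* With [P * L] rows, every class modulo [P] has exactly [L] members; the nonzero factor [P] is then
   cancelled over the integers. *)
suff eqPL : fan_count m rho (P * L) x = fan_count m rho (P * L) y.
  have := fan_count_mul P x y m_odd mL hL; rewrite eqPL subrr => /esym/eqP.
  by rewrite mulf_eq0 subr_eq0 => /orP[/eqP|/eqP //]; lia.
apply/eqP; rewrite -subr_eq0 !class_sum -sumrB.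
under eq_bigr => t _ do rewrite (sum_row_count_class P t m_odd mL) -mulrBr.
(* What remains is a multiple of the difference of two fan counts modulo gcd(P, m), with [P]
   rows. *)
rewrite -mulr_sumr sumrB -!/(fan_count _ _ _ _).
have gm : (gcdn P m %| m)%N by exact: dvdn_gcdr.
rewrite (IH (gcdn P m) _ P x y) ?subrr ?mulr0 //.
- by apply: leq_ltn_trans (totient_lt m_gt1); rewrite dvdn_leq // dvdn_gcdl.
- exact: dvdn_odd gm m_odd.
- exact: dvdn_gcdl.
- exact: pm1_mod_dvd hP.
Qed.

(** * The orbit of an arithmetic progression *)

Lemma aca_affine (m r : nat) (W : r.*2.+1.-tuple int) (u : int -> Zmod m)
    (b c : Zmod m) : (forall i, u i = b + c *~ i) ->
  forall i, aca W u i = b *~ sigma W + c *~ sigma' W + c *~ (sigma W * i).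
Proof.
move=> hu i; rewrite /aca /sigma /sigma' mulr_suml !mulrz_sumr -!big_split /=.
apply: eq_bigr => k _; rewrite hu mulrzDl_tmp -mulrzA -addrA -mulrzDr_tmp.
by congr (_ + c *~ _); ring.
Qed.

Lemma aca_orbit_AP_double (m r : nat) (W : r.*2.+1.-tuple int) (a d : Zmod m) :
  sigma W = 2 * sigma' W -> forall (j : nat) (i : int),
  aca_orbit W (AP a d) i j *+ 2 =
  (a *+ 2 + d *~ (i *+ 2 + j%:Z)) *~ (sigma W ^+ j).
Proof.
move=> hW j.
(* Every row is again an arithmetic progression. Its term [b] in column 0 is tracked through its
   double, since 2 sigma' = sigma then raises the coefficient of [d] by exactly one per row. *)
suff [b hb b2] : exists2 b : Zmod m,
    forall i, aca_orbit W (AP a d) i j = b + d *~ (sigma W ^+ j * i) &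
    b *+ 2 = (a *+ 2 + d *~ j%:Z) *~ (sigma W ^+ j).
  move=> i; rewrite hb mulrnDl b2 !mulrzDl_tmp -addrA; congr (_ + _).
  rewrite -!mulrzA -[X in _ + X]/((_ *~ _) *~ (2%:Z)) -mulrzA -mulrzDr_tmp.
  by congr (d *~ _); ring.
elim: j => [|j [b hb b2]].
  by exists a => [i|]; rewrite ?expr0 ?mul1r ?mulr0z ?addr0.
exists (b *~ sigma W + d *~ (sigma W ^+ j) *~ sigma' W) => [i|].
  rewrite /aca_orbit iterS (@aca_affine _ _ _ _ b (d *~ (sigma W ^+ j))).
    by rewrite -!mulrzA; congr (_ + d *~ _); rewrite exprS; ring.
  by move=> k; rewrite -[LHS]/(aca_orbit W (AP a d) k j) hb mulrzA.
rewrite mulrnDl -[b *~ _ *+ 2]/(b *~ _ *~ 2%:Z) mulrzAC -[b *~ 2]/(b *+ 2) b2.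
rewrite -[X in _ + X]/(_ *~ (2%:Z)) !mulrzDl_tmp -!mulrzA -addrA -mulrzDr_tmp.
rewrite -!mulrzDr_tmp (mulrC (sigma' W)) -hW exprSr intS.
by congr (a *~ _ + d *~ _); ring.
Qed.

(** * From triangles to fan counts *)

Lemma count_triangle (m : nat) (A : int -> nat -> Zmod m) (j : int * nat)
    (e : int * int) (s : nat) (rho y : int) (x : Zmod m) :
  (forall n k, (n < s)%N -> (k <= n)%N -> (entry A j e k (s - 1 - n) == x) =
     (m%:Z %| k%:Z *+ 2 - n%:Z - rho ^+ n * y)%Z) ->
  (count_mem x (triangle A j e s))%:Z = fan_count m rho s y.
Proof.
move=> hA; rewrite /triangle -sum1_count big_image_cond big_mkcondr /=.
rewrite (big_morph Posz PoszD (erefl _)).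
rewrite -(pair_big_dep xpredT (fun k1 k2 : 'I_s => (k1 + k2 <= s - 1)%N)
  (fun k1 k2 : 'I_s => (if entry A j e k1 k2 == x then 1%N else 0%N)%:Z)) /=.
(* Rows are reindexed by n = s - 1 - k2, so that row [n] has n + 1 entries. *)
rewrite (exchange_big_dep xpredT) //= (reindex_inj rev_ord_inj) /=.
apply: eq_bigr => n _; have n_lt := ltn_ord n.
rewrite /row_count (big_ord_widen s (fun k => (nat_of_bool
  (m%:Z %| k%:Z *+ 2 - n%:Z - rho ^+ n * y)%Z)%:Z)) //.
apply: eq_big => [k|k hk]; first by lia.
rewrite -hA //; last by lia.
by rewrite (_ : (s - n.+1)%N = (s - 1 - n)%N); [case: eqP | lia].
Qed.

Lemma Zp_intr_eq0 (p : nat) (z : int) :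
  ((z%:~R : 'I_p.+2) == 0) = (p.+2%:Z %| z)%Z.
Proof.
have nat_eq0 n : ((n%:R : 'I_p.+2) == 0) = (p.+2 %| n)%N.
  by rewrite Zp_nat -val_eqE.
case: z => n; first exact: nat_eq0.
by rewrite NegzE dvdzN mulrNz oppr_eq0 nat_eq0.
Qed.

Lemma Zp_pm1 (p : nat) (z : int) :
  pm1_mod p.+2 z = ((z%:~R : 'I_p.+2) == 1) || ((z%:~R : 'I_p.+2) == -1).
Proof.
by rewrite /pm1_mod -!Zp_intr_eq0 rmorphB rmorphD subr_eq0 addr_eq0.
Qed.

(** If L = s + 1, the extra row has s + 1 entries, a multiple of [m], so it is balanced by itself
    and can be removed. *)
Lemma fan_count_const_size (m : nat) (rho : int) (s L : nat) (x y : int) :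
  odd m -> (m %| L)%N -> pm1_mod m (rho ^+ L) -> L = s \/ L = s.+1 ->
  fan_count m rho s x = fan_count m rho s y.
Proof.
move=> m_odd mL hL [Ls|Ls]; first by rewrite -Ls; exact: fan_count_const.
have := fan_count_const x y m_odd mL hL; rewrite Ls in mL *.
rewrite /fan_count !big_ord_recr /=.
by rewrite (row_count_const (rho ^+ s * x) (rho ^+ s * y) m_odd mL) => /addIr.
Qed.

Lemma mulr2n_unit_inj (R : comUnitRingType) : (2%:R : R) \is a GRing.unit ->
  injective (fun x : R => x *+ 2).
Proof.
move=> u2 x y /=; rewrite -[x *+ 2]mulr_natr -[y *+ 2]mulr_natr .
exact: mulIr.
Qed.

(** Adding the doubled entries [v] and [v'] gives twice (a2 + d c) w, where 2 and [w] are units. *)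
Lemma antisym_center (R : comUnitRingType) (v v' a2 d u u' c w : R) :
  (2%:R : R) \is a GRing.unit -> w \is a GRing.unit ->
  v *+ 2 = (a2 + d * u) * w -> v' *+ 2 = (a2 + d * u') * w ->
  u + u' = c *+ 2 -> v + v' = 0 -> a2 + d * c = 0.
Proof.
move=> u2 uw hv hv' huc vv'; apply: (mulIr uw); apply: (mulr2n_unit_inj u2) => /=.
rewrite mul0r mul0rn.
have -> : (a2 + d * c) * w *+ 2 = (a2 + a2 + d * (c *+ 2)) * w by ring.
rewrite -huc (_ : _ * w = (a2 + d * u) * w + (a2 + d * u') * w); last by ring.
by rewrite -hv -hv' -mulrnDl vv' mul0rn.
Qed.

(** Multiplying v = x by the unit 2q gives d C z = 2 q x. With q = rho^n and [C] common to all rows,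
    the target 2x / (d C) is common too. *)
Lemma scaled_entry_eq (R : comUnitRingType) (v x d C q eps w z : R) :
  (2%:R : R) \is a GRing.unit -> d \is a GRing.unit -> C \is a GRing.unit ->
  q \is a GRing.unit -> v *+ 2 = d * (eps * z) * w -> eps * w * q = C ->
  (v == x) = (z - q * (x *+ 2 / (d * C)) == 0).
Proof.
move=> u2 ud uC uq hv hC; have udC : d * C \is a GRing.unit by rewrite unitrM ud.
rewrite subr_eq0 -[RHS](inj_eq (mulIr udC)) -[q * _ * _]mulrA divrK //.
rewrite -[LHS](inj_eq (mulr2n_unit_inj u2)) hv -[LHS](inj_eq (mulIr uq)).
congr (_ == _); last by ring.
by rewrite -hC; ring.
Qed.

Lemma pord_dvd_pm1 (m : nat) (x : int) (hx : invertible_mod m x) (L : nat) :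
  (pord hx %| L)%N -> pm1_mod m (x ^+ L).
Proof.
rewrite /pord; case: ex_minnP => k /andP[_ hk] _ /dvdnP[q ->].
rewrite mulnC exprM; apply: pm1_modX.
by rewrite /pm1_mod -eqz_mod_dvd -[X in _ || (_ %| _ + X)%Z]opprK -eqz_mod_dvd.
Qed.

Lemma size_cases (s M : nat) :
  (s%:Z = 0 %[mod M%:Z])%Z \/ (s%:Z = -1 %[mod M%:Z])%Z ->
  exists2 L, (M %| L)%N & L = s \/ L = s.+1.
Proof.
case=> /eqP; rewrite eqz_mod_dvd.
- by rewrite subr0 => h; exists s => //; left.
- by rewrite opprK -PoszD addn1 => h; exists s.+1 => //; right.
Qed.

Theorem theorem5p5 (m : nat) (hm : odd m)
  (r : nat) (W : r.*2.+1.-tuple int)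
  (hW : sigma W = 2 * sigma' W)
  (hsigma : invertible_mod m (sigma W))
  (a d : Zmod m) (hd : invertible d)
  (s : nat) (hs : (0 < s)%N)
  (hsmod : (s%:Z = 0 %[mod (lcmn (pord hsigma) m)%:Z])%Z \/
           (s%:Z = -1 %[mod (lcmn (pord hsigma) m)%:Z])%Z)
  (j : int * nat) (e : int * int)
  (he : e = (1, 1) \/ e = (-1, -1))
  (hrange : triangle_in_range j e s)
  (hanti : antisymmetric01 (aca_orbit W (AP a d)) j e s) :
  balanced (triangle (aca_orbit W (AP a d)) j e s).
Proof.
have [L hL Ls] := size_cases hsmod.
have mL : (m %| L)%N by apply: dvdn_trans (dvdn_lcmr _ _) hL.
have sigmaL : pm1_mod m (sigma W ^+ L).
  by apply: (@pord_dvd_pm1 _ _ hsigma); apply: dvdn_trans (dvdn_lcml _ _) hL.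
have dbl := aca_orbit_AP_double a d hW.
have [t ht] := hsigma.
(* For m = 1 all elements coincide; for m = p + 2 the ring structure on ['I_p.+2] is available. *)
case: m hm a d hd mL sigmaL hanti dbl ht {hsigma hsmod hL} =>
  [//|[|p]] hm a d hd mL sigmaL hanti dbl ht.
  by move=> x y; congr (count_mem _ _); rewrite [x]ord1 [y]ord1.
pose S : 'I_p.+2 := (sigma W)%:~R.
have {dbl}dbl i k : aca_orbit W (AP a d) i k *+ 2 =
    (a *+ 2 + d * (i *+ 2 + k%:Z)%:~R) * S ^+ k.
  by rewrite dbl /S -rmorphXn /= !mulrzr.
have St : S * t%:~R = 1.
  apply/eqP; rewrite -subr_eq0 /S -rmorphM -[1]/(1%:~R) -rmorphB /= Zp_intr_eq0.
  by rewrite -eqz_mod_dvd ht.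
have Su : S \is a GRing.unit by apply/unitrPr; exists t%:~R.
have du : d \is a GRing.unit by case: hd => d' dd'; apply/unitrPr; exists d'.
have u2 : (2%:R : 'I_p.+2) \is a GRing.unit.
  apply/unitrPr; exists (p.+2./2.+1)%:R; rewrite -natrM.
  have -> : (2 * p.+2./2.+1 = p.+2 + 1)%N.
    by have := odd_double_half p.+2; rewrite hm; lia.
  rewrite natrD; suff /eqP -> : ((p.+2)%:R : 'I_p.+2) == 0 by rewrite add0r.
  by rewrite (Zp_intr_eq0 p p.+2%:Z) dvdzz.
have [eps eE heps] : exists2 eps : int, e = (eps, eps) & eps = 1 \/ eps = -1.
  by case: he => ->; [exists 1 => //; left | exists (-1) => //; right].
rewrite {he}eE {e eE} in hrange hanti *.
have hJ n : (n < s)%N ->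
    `|(j.2%:Z + eps * (s - 1 - n)%N%:Z)%R|%N%:Z = j.2%:Z + eps * (s - 1 - n)%N%:Z.
  by move=> n_lt; rewrite gez0_abs // (hrange 0%N) // add0n leq_subr.
(* Antisymmetry at k = (0, 0) pairs the two ends of the row through the principal vertex. *)
have center : a *+ 2 + d * (j.1 *+ 2 + j.2%:Z + eps * (s - 1)%N%:Z)%:~R = 0.
  apply: (antisym_center u2 (unitrX j.2 Su) (dbl j.1 j.2)
    (dbl (j.1 + eps * (s - 1)%N%:Z) j.2)).
    by rewrite [RHS]mulr2n -!intrD; congr (_%:~R); ring.
  by have := hanti 0%N 0%N isT; rewrite /entry /= !mulr0 !addr0 !subn0.
have entryE n k : (n < s)%N -> (k <= n)%N ->
    entry (aca_orbit W (AP a d)) j (eps, eps) k (s - 1 - n) *+ 2 =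
    d * (eps%:~R * (k%:Z *+ 2 - n%:Z)%:~R) *
      S ^+ `|(j.2%:Z + eps * (s - 1 - n)%N%:Z)%R|%N.
  move=> n_lt k_le; rewrite /entry /= dbl hJ //; congr (_ * _).
  (* Subtracting the centre leaves eps (2k - n), as both coordinates carry the same sign [eps]. *)
  rewrite -[LHS]subr0 -center opprD addrACA subrr add0r -mulrBr -intrB -intrM.
  by congr (d * _%:~R); case: heps => ->; lia.
have [rho [C [uC urho rhoL hC]]] : exists (rho : int) (C : 'I_p.+2),
    [/\ C \is a GRing.unit, (rho%:~R : 'I_p.+2) \is a GRing.unit,
      pm1_mod p.+2 (rho ^+ L) & forall n, (n < s)%N ->
      eps%:~R * S ^+ `|(j.2%:Z + eps * (s - 1 - n)%N%:Z)%R|%N * (rho ^+ n)%:~R = C].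
  (* Take rho = sigma for eps = 1 and its inverse [t] for eps = -1; [C] is [eps] times the power of
     sigma at the height of the row n = 0. *)
  case: heps => eps1.
    exists (sigma W), (S ^+ (j.2 + (s - 1))); split => //; first exact: unitrX.
    move=> n n_lt; rewrite eps1 mulr1z !mul1r rmorphXn /= -/S -exprD; congr (S ^+ _).
    by have := hJ _ n_lt; rewrite eps1; lia.
  exists t, (- S ^+ (j.2 - (s - 1))); split.
  - by rewrite unitrN unitrX.
  - by apply/unitrPr; exists S; rewrite mulrC.
  - move: sigmaL; rewrite !Zp_pm1 !rmorphXn /= -/S.
    have : S ^+ L * t%:~R ^+ L = 1 by rewrite -exprMn St expr1n.
    move=> SL /orP[] /eqP SL1; move: SL; rewrite SL1 ?mulN1r ?mul1r.
      by move=> ->; rewrite eqxx.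
    by move/eqP; rewrite eqr_oppLR => ->; rewrite orbT.
  move=> n n_lt; rewrite rmorphXn /=.
  (* The range condition at n = 0 gives s - 1 <= j.2, so the natural subtraction is exact. *)
  have -> : `|(j.2%:Z + eps * (s - 1 - n)%N%:Z)%R|%N = (j.2 - (s - 1) + n)%N.
    by have := hJ _ n_lt; have := hJ 0%N hs; rewrite eps1; lia.
  by rewrite eps1 mulrN1z mulN1r mulNr exprD -mulrA -exprMn St expr1n mulr1.
have countE x : (count_mem x (triangle (aca_orbit W (AP a d)) j (eps, eps) s))%:Z =
    fan_count p.+2 rho s (nat_of_ord (x *+ 2 / (d * C))).
  apply: count_triangle => n k n_lt k_le.
  rewrite -Zp_intr_eq0 intrB intrM -[X in _ * X]/(_%:R) natr_Zp.
  apply: (scaled_entry_eq x u2 du uC _ (entryE n k n_lt k_le) (hC n n_lt)).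
  by rewrite rmorphXn unitrX.
move=> x y; apply/eqP; rewrite -eqz_nat !countE; apply/eqP.
exact: fan_count_const_size hm mL rhoL Ls.
Qed.
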